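(* Let $N\in\mathbb{N}$ and let $\{S_n,\ n=0,1,\ldots\}$ be a discrete-time birth-death chain on the spider $\mathbb{S}_N$ with $N$ legs and transition probability matrix $\bm P$, let $\bm W$ be the associated weight matrix on $[-1,1]$, and let $\omega_1,\ldots,\omega_N$ be the associated scalar spectral probability measures (all as defined in the context). Then, for $z\in\mathbb{C}\setminus\mathbb{R}$, the Stieltjes transform of $\bm W$ can be written in block form (blocks of sizes $1$ and $N-1$) as $$B(z;\bm W)=\left(\begin{array}{c|c}0&\bm 0\\ \hline \bm 0&B(z;\bm\omega_D)\,\bm c_D\,\bm\alpha_D^{-1}\end{array}\right)+\mathfrak{b}(z)\left(\begin{array}{c|c}1&-\vec{\bm c}^{\,T}B(z;\bm\omega_D)\\ \hline -B(z;\bm\omega_D)\vec{\bm c}&B(z;\bm\omega_D)\,\vec{\bm c}\,\vec{\bm c}^{\,T}B(z;\bm\omega_D)\end{array}\right),$$ where $$\mathfrak{b}(z)=\frac{1}{\dfrac{1}{B(z;\omega_N)}-\vec{\bm\alpha}^{\,T}B(z;\bm\omega_D)\,\vec{\bm c}}.$$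
   Context: **Birth-death chain on a spider.** For $N\in\mathbb{N}$ let $\mathbb{S}_N=\{v_N(k,m): k\in\mathbb{N}_0,\ m=1,\ldots,N\}$ with $v_N(k,m)=k\exp(2\pi i(m-1)/N)$; the point $v_N(0):=v_N(0,m)$ (the same for all $m$) is the body of the spider and $N$ is the number of legs. A homogeneous discrete-time birth-death chain $\{S_n\}$ on $\mathbb{S}_N$ is a Markov chain with transition probabilities: from $v_N(0)$ to $v_N(0)$ with probability $\alpha_0$ and from $v_N(0)$ to $v_N(1,m)$ with probability $\alpha_m$, $m=1,\ldots,N$, where $\sum_{m=0}^N\alpha_m=1$; and, for $k\ge1$ and $m=1,\ldots,N$, from $v_N(k,m)$ to $v_N(k+1,m)$, $v_N(k,m)$, $v_N(k-1,m)$ with probabilities $a_{k,m}$, $b_{k,m}$, $c_{k,m}$ respectively, where $a_{k,m}+b_{k,m}+c_{k,m}=1$. It is assumed that $\alpha_m>0$ ($m=1,\ldots,N$), $a_{k,m}>0$, $c_{k,m}>0$, and $\alpha_0\ge 0$, $b_{k,m}\geq 0$. **Transition matrix.** Label the states so that $v_N(0)$ is $0$, the points $v_N(1,1),\ldots,v_N(1,N)$ are $1,\ldots,N$, the points $v_N(2,1),\ldots,v_N(2,N)$ are $N+1,\ldots,2N$, and so on. Grouping the states in blocks of $N$ consecutive labels, the transition matrix is $$\bm P=\begin{pmatrix}\bm B_0&\bm A_0&&&\\ \bm C_1&\bm B_1&\bm A_1&&\\ &\bm C_2&\bm B_2&\bm A_2&\\ &&\ddots&\ddots&\ddots\end{pmatrix},$$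 where $$\bm B_0=\begin{pmatrix}\alpha_0&\alpha_1&\alpha_2&\cdots&\alpha_{N-1}\\ c_{1,1}&b_{1,1}&0&\cdots&0\\ c_{1,2}&0&b_{1,2}&\cdots&0\\ \vdots&\vdots&\vdots&\ddots&\vdots\\ c_{1,N-1}&0&0&\cdots&b_{1,N-1}\end{pmatrix},\quad \bm A_0=\mathrm{diag}(\alpha_N,a_{1,1},\ldots,a_{1,N-1}),$$ and for $n\ge1$ $$\bm A_n=\mathrm{diag}(a_{n,N},a_{n+1,1},\ldots,a_{n+1,N-1}),\quad \bm B_n=\mathrm{diag}(b_{n,N},b_{n+1,1},\ldots,b_{n+1,N-1}),\quad \bm C_n=\mathrm{diag}(c_{n,N},c_{n+1,1},\ldots,c_{n+1,N-1}).$$ **Weight matrix $\bm W$.** Let $(\bm Q_n)_{n\ge0}$ be the $N\times N$ matrix-valued polynomials generated by $$x\bm Q_n(x)=\bm A_n\bm Q_{n+1}(x)+\bm B_n\bm Q_n(x)+\bm C_n\bm Q_{n-1}(x),\quad n\geq0,\qquad \bm Q_0(x)=\bm I_N,\quad \bm Q_{-1}(x)=\bm 0.$$ A weight matrix is an $N\times N$ matrix of measures, symmetric and nonnegative definite on every Borel set, with finite moments. Let $$\pi_{0,N}=1,\quad \pi_{n,N}=\alpha_N\frac{a_{1,N}\cdots a_{n-1,N}}{c_{1,N}\cdots c_{n,N}}\ (n\ge1),\qquad \pi_{1,k}=\frac{\alpha_k}{c_{1,k}},\quad \pi_{n+1,k}=\alpha_k\frac{a_{1,k}\cdots a_{n,k}}{c_{1,k}\cdots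 c_{n+1,k}}\ (n\ge1),\quad k=1,\ldots,N-1,$$ and $\bm\Pi_n=\mathrm{diag}(\pi_{n,N},\pi_{n+1,1},\ldots,\pi_{n+1,N-1})$, $n\ge0$. Then $\bm W$ denotes the weight matrix supported on $[-1,1]$ for which $$\int_{-1}^1\bm Q_n(x)\,d\bm W(x)\,\bm Q_m^T(x)=\bm\Pi_n^{-1}\delta_{nm},\qquad n,m\ge0$$ (such a $\bm W$ exists). **Scalar measures.** With $a_{0,N}=\alpha_N$ and $b_{0,N}=\alpha_0$, let $(Q_{n,N})_{n\ge0}$ be the scalar polynomials given by $xQ_{n,N}=a_{n,N}Q_{n+1,N}+b_{n,N}Q_{n,N}+c_{n,N}Q_{n-1,N}$, $n\ge0$, $Q_{0,N}=1$, $Q_{-1,N}=0$. For $k=1,\ldots,N-1$ let $(Q_{n,k})_{n\ge0}$ be given by $xQ_{n,k}=a_{n+1,k}Q_{n+1,k}+b_{n+1,k}Q_{n,k}+c_{n+1,k}Q_{n-1,k}$, $n\ge0$, $Q_{0,k}=1$, $Q_{-1,k}=0$. For $k=1,\ldots,N$, $\omega_k$ denotes the probability measure supported on $[-1,1]$ with respect to which $(Q_{n,k})_{n\ge0}$ are orthogonal. **Notation.** The Stieltjes transform of a measure $\omega$ on the real line is $B(z;\omega)=\int_{\mathbb{R}}\frac{d\omega(x)}{x-z}$, $z\in\mathbb{C}\setminus\mathbb{R}$; for matrices of measures it is taken entrywise. Further, $\vec{\bm\alpha}=(\alpha_1,\ldots,\alpha_{N-1})^T$, $\bm\alpha_D=\mathrm{diag}(\alpha_1,\ldots,\alpha_{N-1})$,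 $\vec{\bm c}=(c_{1,1},\ldots,c_{1,N-1})^T$, $\bm c_D=\mathrm{diag}(c_{1,1},\ldots,c_{1,N-1})$, $\bm\omega_D=\mathrm{diag}(\omega_1,\ldots,\omega_{N-1})$, so that $B(z;\bm\omega_D)=\mathrm{diag}(B(z;\omega_1),\ldots,B(z;\omega_{N-1}))$. *)

(* Defs.v *)
From HB Require Import structures.
From mathcomp Require Import all_boot all_order all_algebra.
From mathcomp Require Import complex.
From mathcomp Require Import all_classical all_reals all_analysis.

Set Implicit Arguments.
Unset Strict Implicit.
Unset Printing Implicit Defensive.

Import Order.TTheory GRing.Theory Num.Theory.
Import numFieldNormedType.Exports.

Local Open Scope classical_set_scope.
Local Open Scope ring_scope.
Local Open Scope complex_scope.

(* Legs are numbered 1..N; the rates [alpha m], [a k m],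
   [b k m], [c k m] are only meaningful for 0 <= m <= N, respectively for
   k >= 1 and 1 <= m <= N, and are unconstrained elsewhere. *)

Definition spider_vertex (R : realType) (N k m : nat) : R[i] :=
  (k%:R * cos (2 * pi * (m%:R - 1) / N%:R)) +i*
  (k%:R * sin (2 * pi * (m%:R - 1) / N%:R)).

Definition spider (R : realType) (N : nat) : set R[i] :=
  [set v | exists k m, (1 <= m <= N)%N /\ v = spider_vertex R N k m].

Definition spider_rates (R : realType) (N : nat) (alpha : nat -> R)
    (a b c : nat -> nat -> R) : Prop :=
  [/\ \sum_(0 <= m < N.+1) alpha m = 1,
      0 <= alpha 0%N,
      forall m, (1 <= m <= N)%N -> 0 < alpha m
    & forall k m, (1 <= k)%N -> (1 <= m <= N)%N ->
        [/\ a k m + b k m + c k m = 1, 0 < a k m, 0 <= b k m & 0 < c k m]].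

(* The Markov property and the one-step probabilities are expressed together,
   conditioning on the whole history:
   P(S_0 = s_0, .., S_n = s_n, S_{n+1} = y) =
   P(S_0 = s_0, .., S_n = s_n) * (probability of the move from s_n to y).
   The initial distribution is arbitrary. *)
Definition spider_chain (R : realType) (d : measure_display)
    (T : measurableType d) (Pr : probability T R) (N : nat)
    (alpha : nat -> R) (a b c : nat -> nat -> R) (S : nat -> T -> R[i]) : Prop :=
  let v := spider_vertex R N in
  [/\ forall n w, spider N (S n w),
      forall n y, measurable [set w | S n w = y]
    & forall (n : nat) (s : nat -> R[i]),
      let H := [set w | forall i, (i <= n)%N -> S i w = s i] in
      let moves y p :=
        Pr (H `&` [set w | S n.+1 w = y]) = (Pr H * p%:E)%E in
      (s n = v 0%N 1%N ->
         moves (v 0%N 1%N) (alpha 0%N) /\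
         forall m, (1 <= m <= N)%N -> moves (v 1%N m) (alpha m)) /\
      (forall k m, (1 <= k)%N -> (1 <= m <= N)%N -> s n = v k m ->
         [/\ moves (v k.+1 m) (a k m),
             moves (v k m) (b k m)
           & moves (v k.-1 m) (c k m)])].

(* The conventions a_{0,N} = alpha_N and b_{0,N} = alpha_0. *)
Definition up_rate (R : realType) (N : nat) (alpha : nat -> R)
    (a : nat -> nat -> R) (n k : nat) : R :=
  if n is 0%N then alpha N else a n k.

Definition stay_rate (R : realType) (alpha : nat -> R)
    (b : nat -> nat -> R) (n k : nat) : R :=
  if n is 0%N then alpha 0%N else b n k.

(* diag(f_{n,N}, f_{n+1,1}, .., f_{n+1,N-1}): index 0 stands for leg N,
   index j >= 1 for leg j. *)
Definition legs_diag (R : realType) (N : nat) (f : nat -> nat -> R) (n : nat) :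
    'M[R]_(1 + N.-1) :=
  diag_mx (\row_(j < 1 + N.-1)
             if j == 0%N :> nat then f n N else f n.+1 j).

Definition blockA (R : realType) (N : nat) (alpha : nat -> R)
    (a : nat -> nat -> R) (n : nat) : 'M[R]_(1 + N.-1) :=
  legs_diag N (up_rate N alpha a) n.

Definition alpha_vec (R : realType) (N : nat) (alpha : nat -> R) :
    'cV[R]_(N.-1) := \col_(k < N.-1) alpha k.+1.

Definition c_vec (R : realType) (N : nat) (c : nat -> nat -> R) :
    'cV[R]_(N.-1) := \col_(k < N.-1) c 1%N k.+1.

Definition blockB (R : realType) (N : nat) (alpha : nat -> R)
    (b c : nat -> nat -> R) (n : nat) : 'M[R]_(1 + N.-1) :=
  if n is 0%N then
    block_mx (alpha 0%N)%:M (alpha_vec N alpha)^T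
             (c_vec N c)    (diag_mx (\row_(k < N.-1) b 1%N k.+1))
  else legs_diag N b n.

(* Only used for n >= 1. *)
Definition blockC (R : realType) (N : nat) (c : nat -> nat -> R) (n : nat) :
    'M[R]_(1 + N.-1) := legs_diag N c n.

(* pi_{n,k} = alpha_k (a_{1,k} .. a_{n-1,k}) / (c_{1,k} .. c_{n,k}) for n >= 1;
   the value 1 at n = 0 only matters for k = N. *)
Definition spider_pi (R : realType) (alpha : nat -> R)
    (a c : nat -> nat -> R) (n k : nat) : R :=
  if n is 0%N then 1 else
  alpha k * (\prod_(1 <= i < n) a i k) / (\prod_(1 <= i < n.+1) c i k).

Definition blockPi (R : realType) (N : nat) (alpha : nat -> R)
    (a c : nat -> nat -> R) (n : nat) : 'M[R]_(1 + N.-1) :=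
  legs_diag N (spider_pi alpha a c) n.

(* [prev Q n] is Q_{n-1}, with Q_{-1} = 0. *)
Definition prev (V : nmodType) (Q : nat -> V) (n : nat) : V :=
  if n is n'.+1 then Q n' else 0.

Definition matrix_recurrence (R : realType) (r : nat)
    (A B C : nat -> 'M[R]_r) (Q : nat -> 'M[{poly R}]_r) : Prop :=
  Q 0%N = 1%:M /\
  forall n, 'X *: Q n = map_mx polyC (A n) *m Q n.+1
                      + map_mx polyC (B n) *m Q n
                      + map_mx polyC (C n) *m prev Q n.

Definition scalar_recurrence (R : realType) (a b c : nat -> R)
    (q : nat -> {poly R}) : Prop :=
  q 0%N = 1 /\
  forall n, 'X * q n = a n *: q n.+1 + b n *: q n + c n *: prev q n.

Definition hahn_pos_set (R : realType) (d : measure_display)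
    (T : measurableType d) (nu : {charge set T -> \bar R}) : set T :=
  projT1 (cid (Hahn_decomposition nu)).

Definition hahn_neg_set (R : realType) (d : measure_display)
    (T : measurableType d) (nu : {charge set T -> \bar R}) : set T :=
  projT1 (cid (projT2 (cid (Hahn_decomposition nu)))).

Lemma hahn_setsP (R : realType) (d : measure_display)
    (T : measurableType d) (nu : {charge set T -> \bar R}) :
  hahn_decomposition nu (hahn_pos_set nu) (hahn_neg_set nu).
Proof. exact: projT2 (cid (projT2 (cid (Hahn_decomposition nu)))). Qed.

(* Integral of [f] against the signed measure [nu] = [nu]^+ - [nu]^-. *)
Definition charge_integral (R : realType) (d : measure_display)
    (T : measurableType d) (nu : {charge set T -> \bar R}) (D : set T)
    (f : T -> R) : R :=
  \int[jordan_pos (hahn_setsP nu)]_(x in D) f x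
  - \int[jordan_neg (hahn_setsP nu)]_(x in D) f x.

Definition charge_integrable (R : realType) (d : measure_display)
    (T : measurableType d) (nu : {charge set T -> \bar R}) (D : set T)
    (f : T -> R) : Prop :=
  (jordan_pos (hahn_setsP nu)).-integrable D (EFin \o f) /\
  (jordan_neg (hahn_setsP nu)).-integrable D (EFin \o f).

Definition orthogonality_measure (R : realType)
    (om : probability (measurableTypeR R) R) (q : nat -> {poly R}) : Prop :=
  om `[-1, 1]%classic = 1%E /\
  forall n m, n <> m -> \int[om]_(x in `[-1, 1]%classic) ((q n).[x] * (q m).[x]) = 0.

Definition mxcharge_val (R : realType) (r : nat)
    (W : 'I_r -> 'I_r -> {charge set (measurableTypeR R) -> \bar R})
    (E : set (measurableTypeR R)) : 'M[R]_r :=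
  \matrix_(i, j) fine (W i j E).

(* Charges are finite on every measurable set, hence the use of [fine]. *)
Definition weight_matrix (R : realType) (r : nat)
    (W : 'I_r -> 'I_r -> {charge set (measurableTypeR R) -> \bar R}) : Prop :=
  (forall E : set (measurableTypeR R), measurable E ->
     (mxcharge_val W E)^T = mxcharge_val W E /\
     forall u : 'cV[R]_r, 0 <= (u^T *m mxcharge_val W E *m u) 0 0) /\
  (forall i j (n : nat), charge_integrable (W i j) setT (fun x => x ^+ n)).

Definition supported_on (R : realType) (r : nat)
    (W : 'I_r -> 'I_r -> {charge set (measurableTypeR R) -> \bar R})
    (D : set (measurableTypeR R)) : Prop :=
  forall E : set (measurableTypeR R), measurable E -> E `&` D = set0 ->
  forall i j, W i j E = 0%E.

(* Entries of \int_D F(x) dW(x) G(x). *)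
Definition mxintegral (R : realType) (r : nat)
    (W : 'I_r -> 'I_r -> {charge set (measurableTypeR R) -> \bar R})
    (D : set (measurableTypeR R)) (F G : R -> 'M[R]_r) : 'M[R]_r :=
  \matrix_(i, j) \sum_k \sum_l
    charge_integral (W k l) D (fun x => F x i k * G x l j).

Definition mx_eval (R : realType) (r : nat) (Q : 'M[{poly R}]_r) (x : R) :
    'M[R]_r := map_mx (horner^~ x) Q.

Definition spider_weight (R : realType) (N : nat) (alpha : nat -> R)
    (a c : nat -> nat -> R) (Q : nat -> 'M[{poly R}]_(1 + N.-1))
    (W : 'I_(1 + N.-1) -> 'I_(1 + N.-1) ->
         {charge set (measurableTypeR R) -> \bar R}) : Prop :=
  [/\ weight_matrix W, supported_on W `[-1, 1]%classic
    & forall n m,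
        mxintegral W `[-1, 1]%classic (mx_eval (Q n)) (fun x => (mx_eval (Q m) x)^T)
        = if n == m then invmx (blockPi N alpha a c n) else 0].

Definition stieltjes (R : realType)
    (mu : {measure set (measurableTypeR R) -> \bar R}) (z : R[i]) : R[i] :=
  (\int[mu]_x complex.Re ((x%:C - z)^-1)) +i*
  (\int[mu]_x complex.Im ((x%:C - z)^-1)).

Definition charge_stieltjes (R : realType)
    (nu : {charge set (measurableTypeR R) -> \bar R}) (z : R[i]) : R[i] :=
  charge_integral nu setT (fun x => complex.Re ((x%:C - z)^-1)) +i*
  charge_integral nu setT (fun x => complex.Im ((x%:C - z)^-1)).

Definition mx_stieltjes (R : realType) (r : nat)
    (W : 'I_r -> 'I_r -> {charge set (measurableTypeR R) -> \bar R})
    (z : R[i]) : 'M[R[i]]_r :=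
  \matrix_(i, j) charge_stieltjes (W i j) z.

Definition diag_stieltjes (R : realType) (N : nat)
    (omega : nat -> probability (measurableTypeR R) R) (z : R[i]) :
    'M[R[i]]_(N.-1) :=
  diag_mx (\row_(k < N.-1) stieltjes (omega k.+1) z).

Definition toC_mx (R : realType) (m n : nat) (A : 'M[R]_(m, n)) :
    'M[R[i]]_(m, n) := map_mx (fun x : R => x%:C) A.

Definition spider_b (R : realType) (N : nat) (alpha : nat -> R)
    (c : nat -> nat -> R) (omega : nat -> probability (measurableTypeR R) R)
    (z : R[i]) : R[i] :=
  1 / (1 / stieltjes (omega N) z
       - ((toC_mx (alpha_vec N alpha))^T *m diag_stieltjes N omega z
            *m toC_mx (c_vec N c)) 0 0).

(* Main.v *)
Require Import Defs.
From HB Require Import structures.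
From mathcomp Require Import all_boot all_order all_algebra.
From mathcomp Require Import complex.
From mathcomp Require Import all_classical all_reals all_analysis.
From mathcomp Require Import measurable_realfun ring lra.

Set Implicit Arguments.
Unset Strict Implicit.
Unset Printing Implicit Defensive.

Import Order.TTheory GRing.Theory Num.Theory.
Import numFieldNormedType.Exports.

Local Open Scope classical_set_scope.
Local Open Scope ring_scope.
Local Open Scope complex_scope.

(** The Stieltjes transform of an orthogonality measure is the Green function of
    the underlying operator at the starting site. Put
    U_n(z) = \int Q_n(x) dW(x) / (x - z). Since x / (x - z) = 1 + z / (x - z),
    the recurrence of the Q_n and the orthogonality to Q_0 = 1 give
    (P - z) U = Pi_0^{-1} delta_0, and U_0 is the Stieltjes transform of W. In the
    same way u_n(z) = \int q_n(x) d omega(x) / (x - z) solves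
    (J - z) u = delta_0 for the Jacobi operator J of a single leg, and u_0 is
    the Stieltjes transform of omega ([scalar_resolvent_eq]).

    These solutions are identified by uniqueness. By Bessel's inequality
    ([mxpairing_l2], [scalar_l2]) they are square summable for the reversible
    weights pi, and for non-real z a square summable solution of (J - z) f = 0
    vanishes: J is symmetric for pi, so the imaginary part of <(J - z) f, f> is
    -(Im z) |f|^2 up to a boundary term that tends to zero
    ([jacobi_uniqueness]). Hence a solution with source w delta_0 is w times u
    ([resolvent_at0_proportional]).

    Restrict a column f of U to one leg. With beta_k the Stieltjes transform of
    omega_k and s the source, the body acts on leg k < N as an extra source at
    its first site, so f(1,k) = (s_k - c_{1,k} f(0)) beta_k; the body belongs
    to leg N, on which the other legs act as an extra source, so
    f(0) = (s_0 - \sum_k alpha_k f(1,k)) beta_N ([foot_leg_resolvent],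
    [body_leg_resolvent]). This linear system, solved for each column, is
    the formula. Its pivot 1/beta_N - \sum_k alpha_k beta_k c_{1,k} is nonzero
    because the column of the body reads f(0) * pivot = 1.

    Bessel's inequality for W needs that \sum_{kl} \int F_k F_l dW_{kl} is
    nonnegative for continuous F, while nonnegativity is known only for the
    matrices W(E). Riemann-Stieltjes sums bridge the gap
    ([charge_integral_step_cvg], [weight_positive_form]). *)

(** * Bessel's inequality *)

(** Stated for a form that is bilinear only on a linear subspace D, because the
    integrals below are additive on continuous functions only. *)
Lemma bessel_inequality (R : realFieldType) (V : lmodType R) (D : V -> Prop)
    (B : V -> V -> R)
    (D_closed : forall t u v, D u -> D v -> D (t *: u + v))
    (B_linear : forall t u v w, D u -> D v -> D w ->
       B (t *: u + v) w = t * B u w + B v w)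
    (B_sym : forall u v, D u -> D v -> B u v = B v u)
    (B_ge0 : forall u, D u -> 0 <= B u u)
    (e : nat -> V) (p : nat -> R) (De : forall n, D (e n))
    (p_gt0 : forall n, 0 < p n)
    (e_orth : forall n m, B (e n) (e m) = if n == m then (p n)^-1 else 0)
    (f : V) (Df : D f) (M : nat) :
  \sum_(n < M) p n * B (e n) f ^+ 2 <= B f f.
Proof.
(* g is the component of f orthogonal to the first M vectors *)
suff [g [Dg gg ge]] : exists g, [/\ D g,
    B g g = B f f - \sum_(n < M) p n * B (e n) f ^+ 2
  & forall n, (M <= n)%N -> B (e n) g = B (e n) f].
  by rewrite -subr_ge0 -gg B_ge0.
elim: M => [|M [g [Dg gg ge]]].
  by exists f; split => //; rewrite big_ord0 subr0.
have pM := p_gt0 M.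
pose t := - (p M * B (e M) f).
have Dh := D_closed t _ _ (De M) Dg.
exists (t *: e M + g); split => //.
- rewrite B_linear// !(B_sym _ (t *: e M + g))// !B_linear//.
  rewrite (B_sym g (e M))// e_orth eqxx ge// gg big_ord_recr/= /t.
  by field; rewrite gt_eqF.
- move=> n Mn; rewrite B_sym// B_linear// (B_sym g)// ge ?(ltnW Mn)//.
  by rewrite e_orth ltn_eqF// mulr0 add0r.
Qed.

(** * Uniqueness of square summable solutions *)

Section jacobi.
Context (R : realType).

Definition jacobi_step (a b c : nat -> R) (f : nat -> R) (n : nat) : R :=
  a n * f n.+1 + b n * f n + c n * (if n is m.+1 then f m else 0).

(** The complex equation (J - z) f = w delta_0 for the Jacobi operator J with
    rates a, b, c, written in real and imaginary parts: z = x + iy, w = s + it,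
    f = u + iv. *)
Definition resolvent_eq (a b c : nat -> R) (x y s t : R) (u v : nat -> R) :=
  forall n, jacobi_step a b c u n
              = x * u n - y * v n + (if n == 0%N then s else 0) /\
            jacobi_step a b c v n
              = x * v n + y * u n + (if n == 0%N then t else 0).

Definition weighted_l2 (p u : nat -> R) :=
  exists K, forall M, \sum_(n < M) p n * u n ^+ 2 <= K.

Lemma weighted_l2_lin (p u v : nat -> R) (s : R) : (forall n, 0 < p n) ->
  weighted_l2 p u -> weighted_l2 p v ->
  weighted_l2 p (fun n => u n + s * v n).
Proof.
move=> p0 [K hK] [L hL]; exists (2 * K + 2 * s ^+ 2 * L) => M.
apply: (@le_trans _ _ (2 * (\sum_(n < M) p n * u n ^+ 2) +
   2 * s ^+ 2 * \sum_(n < M) p n * v n ^+ 2)); last first.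
  have s2 : 0 <= 2 * s ^+ 2 by rewrite mulr_ge0// sqr_ge0.
  by rewrite lerD// ler_wpM2l.
rewrite !mulr_sumr -big_split/= ler_sum// => n _.
rewrite -subr_ge0 (_ : _ - _ = p n * (u n - s * v n) ^+ 2); last by ring.
by rewrite mulr_ge0 ?sqr_ge0 ?ltW.
Qed.

Lemma weighted_l2_cvg0 (p u : nat -> R) : (forall n, 0 < p n) ->
  weighted_l2 p u -> (p n * u n ^+ 2) @[n --> \oo] --> 0.
Proof.
move=> p0 [K hK]; apply: cvg_series_cvg_0.
apply: nondecreasing_is_cvgn.
  apply: nondecreasing_series => n _ _.
  by rewrite mulr_ge0 ?sqr_ge0 ?ltW.
by exists K => _ [n _ <-]; rewrite /series/= big_mkord; exact: hK.
Qed.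

Section green.
Variables (a b c p : nat -> R) (x y : R).
Hypothesis p_gt0 : forall n, 0 < p n.
Hypothesis a_ge0 : forall n, 0 <= a n.
Hypothesis a_le1 : forall n, a n <= 1.
Hypothesis c_le1 : forall n, c n.+1 <= 1.
Hypothesis balance : forall n, p n * a n = p n.+1 * c n.+1.

(** The imaginary part of <(J - z) f, f> on the sites 0, ..., M. Symmetry of J for
    the weights p cancels everything but the flux through the last edge
    and the source. *)
Lemma green_identity s t u v : resolvent_eq a b c x y s t u v ->
  forall M, y * \sum_(n < M.+1) p n * (u n ^+ 2 + v n ^+ 2)
   = p M * a M * (u M * v M.+1 - v M * u M.+1) - p 0%N * (u 0%N * t - v 0%N * s).
Proof.
move=> h; elim=> [|M IH].
  rewrite big_ord1/=; have [] := h 0%N; rewrite /jacobi_step/= => h1 h2.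
  have -> : p 0%N * a 0%N * (u 0%N * v 1%N - v 0%N * u 1%N) =
     p 0%N * (u 0%N * (a 0%N * v 1%N + b 0%N * v 0%N + c 0%N * 0)
              - v 0%N * (a 0%N * u 1%N + b 0%N * u 0%N + c 0%N * 0)) by ring.
  by rewrite h1 h2; ring.
rewrite big_ord_recr/= mulrDr IH.
have [] := h M.+1; rewrite /jacobi_step/= => h1 h2.
have -> : p M.+1 * a M.+1 * (u M.+1 * v M.+2 - v M.+1 * u M.+2) =
     p M.+1 * (u M.+1 * (a M.+1 * v M.+2 + b M.+1 * v M.+1 + c M.+1 * v M)
              - v M.+1 * (a M.+1 * u M.+2 + b M.+1 * u M.+1 + c M.+1 * u M))
   - p M.+1 * c M.+1 * (u M.+1 * v M - v M.+1 * u M) by ring.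
by rewrite h1 h2 -balance; ring.
Qed.

Lemma boundary_term_bound u v M :
  `|p M * a M * (u M * v M.+1 - v M * u M.+1)| <=
   (p M * u M ^+ 2 + p M * v M ^+ 2)
   + (p M.+1 * u M.+1 ^+ 2 + p M.+1 * v M.+1 ^+ 2).
Proof.
set q := p M * a M.
have q0 : 0 <= q by rewrite mulr_ge0// ltW.
have qp : q <= p M by rewrite -[leRHS]mulr1 ler_wpM2l// ltW.
have qp' : q <= p M.+1 by rewrite /q balance -[leRHS]mulr1 ler_wpM2l// ltW.
set A := u M ^+ 2 + v M ^+ 2; set B := u M.+1 ^+ 2 + v M.+1 ^+ 2.
have A0 : 0 <= A by rewrite addr_ge0 ?sqr_ge0.
have B0 : 0 <= B by rewrite addr_ge0 ?sqr_ge0.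
apply: (@le_trans _ _ (q * A + q * B)); last first.
  by rewrite -![in leRHS]mulrDr lerD// ler_wpM2r.
rewrite normrM (ger0_norm q0) -mulrDr ler_wpM2l// ler_norml /A /B.
have := sqr_ge0 (u M - v M.+1); have := sqr_ge0 (v M - u M.+1).
have := sqr_ge0 (u M + v M.+1); have := sqr_ge0 (v M + u M.+1).
have := sqr_ge0 (u M); have := sqr_ge0 (v M).
have := sqr_ge0 (u M.+1); have := sqr_ge0 (v M.+1).
by move=> *; apply/andP; split; nra.
Qed.

(** The condition on the source says that conj(f_0) w is real, which removes it
    from [green_identity]; it covers both w = 0 and f_0 = 0. *)
Lemma jacobi_uniqueness s t u v : y != 0 ->
  resolvent_eq a b c x y s t u v ->
  weighted_l2 p u -> weighted_l2 p v ->
  u 0%N * t - v 0%N * s = 0 ->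
  forall n, u n = 0 /\ v n = 0.
Proof.
move=> y0 h hu hv hst.
pose E M := \sum_(n < M) p n * (u n ^+ 2 + v n ^+ 2).
pose bd M := (p M * u M ^+ 2 + p M * v M ^+ 2).
have bd0 : bd M @[M --> \oo] --> 0.
  by rewrite -[0]addr0; apply: cvgD; apply: weighted_l2_cvg0.
have bd1 : (bd M + bd M.+1) @[M --> \oo] --> 0.
  rewrite -[0]addr0; apply: cvgD => //.
  by rewrite (@cvg_shiftS _ bd).
have yE M : `|y| * E M.+1 <= bd M + bd M.+1.
  rewrite -[E _]ger0_norm.
    rewrite -normrM (green_identity h).
    by rewrite hst mulr0 subr0; exact: boundary_term_bound.
  by apply: sumr_ge0 => n _; rewrite mulr_ge0 ?addr_ge0 ?sqr_ge0// ltW.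
have Emono : {homo E : m n / (m <= n)%N >-> m <= n}.
  apply/nondecreasing_seqP => n; rewrite /E big_ord_recr/= lerDl.
  by rewrite mulr_ge0 ?addr_ge0 ?sqr_ge0// ltW.
have E0 M : E M <= 0.
  have y_gt0 : 0 < `|y| by rewrite normr_gt0.
  rewrite -(pmulr_rle0 _ y_gt0); apply: (cvgr_to_ge bd1).
  near=> n; apply: le_trans (yE n); rewrite ler_wpM2l//.
  by apply: Emono; rewrite leqW//; near: n; exact: nbhs_infty_ge.
move=> n; have := E0 n.+1; rewrite /E big_ord_recr/=.
have : 0 <= E n by apply: sumr_ge0 => m _; rewrite mulr_ge0 ?addr_ge0 ?sqr_ge0// ltW.
rewrite -/(E n) => En En1.
have : p n * (u n ^+ 2 + v n ^+ 2) <= 0 by lra.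
rewrite pmulr_rle0// => uv0.
have : u n ^+ 2 + v n ^+ 2 == 0 by rewrite eq_le uv0 addr_ge0 ?sqr_ge0.
by rewrite paddr_eq0 ?sqr_ge0// !sqrf_eq0 => /andP[/eqP -> /eqP ->].
Unshelve. all: by end_near. Qed.
End green.
End jacobi.

(** * Riemann-Stieltjes sums *)

Section step_approximation.
Context (R : realType).
Local Notation U := (`[-1, 1]%classic : set (measurableTypeR R)).
Implicit Types (h : R -> R) (M m : nat) (x : R).

Definition node M m : R := m%:R / M.+1%:R - 1.

Definition cell M m : set (measurableTypeR R) :=
  [set` `[node M m, node M m.+1[].

(** The last cell, starting at 1, is there to cover the right end point. *)
Definition step_fun h M x : R :=
  \sum_(m < (2 * M.+1).+1) h (node M m) * \1_(cell M m) x.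

Definition node_below M x : R := node M (Num.truncn (M.+1%:R * (x + 1))).

Lemma cellP M m x : -1 <= x ->
  cell M m x <-> m = Num.truncn (M.+1%:R * (x + 1)).
Proof.
move=> x1; have M0 : 0 < M.+1%:R :> R by rewrite ltr0n.
have x0 : 0 <= M.+1%:R * (x + 1) by apply: mulr_ge0; [exact: ltW|lra].
rewrite /cell /node/= in_itv/= lerBlDr ltrBrDr ler_pdivrMr// ltr_pdivlMr//.
rewrite (mulrC (x + 1)); split; last by move=> ->; exact: truncn_itv.
by move=> /truncn_def.
Qed.

Lemma node_below_itv M x : -1 <= x -> x - M.+1%:R^-1 <= node_below M x <= x.
Proof.
move=> x1; have := (cellP M _ x1).2 erefl.
rewrite /cell /= in_itv/= => /andP[h1 h2]; rewrite h1 andbT lerBlDr.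
apply: (le_trans (ltW h2)); rewrite /node_below /node le_eqVlt; apply/orP; left.
by apply/eqP; rewrite -[in LHS]natr1 mulrDl mul1r; ring.
Qed.

Lemma node_ge M m : -1 <= node M m.
Proof. by rewrite /node lerBrDr addNr divr_ge0. Qed.

Lemma step_funE h M x : U x -> step_fun h M x = h (node_below M x).
Proof.
rewrite /= in_itv/= => /andP[x1 x2].
have M0 : 0 < M.+1%:R :> R by rewrite ltr0n.
have tlt : (Num.truncn (M.+1%:R * (x + 1)) < (2 * M.+1).+1)%N.
  rewrite ltnS truncn_le_nat -[(2 * M.+1).+1%:R]natr1 natrM.
  have x12 : x + 1 <= 2 by lra.
  by have := ler_wpM2l (ltW M0) x12; lra.
rewrite /step_fun (bigD1 (Ordinal tlt))//= big1 ?addr0.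
  by rewrite indicE mem_set ?mulr1//; exact/cellP.
move=> i it; rewrite indicE memNset ?mulr0// => /cellP -/(_ x1) ie.
by move/eqP : it; apply; exact: val_inj.
Qed.

Lemma node_below_cvg x : -1 <= x -> node_below M x @[M --> \oo] --> x.
Proof.
move=> x1; apply: (@squeeze_cvgr _ _ _ _ (fun M => x - harmonic M) (cst x)).
- by near=> M; rewrite /harmonic/=; exact: node_below_itv.
- rewrite -[X in _ --> X]subr0; apply: cvgB; first exact: cvg_cst.
  exact: cvg_harmonic.
- exact: cvg_cst.
Unshelve. all: by end_near. Qed.

Lemma measurable_cell M m : measurable (cell M m).
Proof. exact: measurable_itv. Qed.

Lemma continuous_bounded h : continuous h ->
  exists K, forall x, U x -> `|h x| <= K.
Proof.
move=> ch; have cU : compact [set h x | x in U].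
  apply: continuous_compact; last exact: segment_compact.
  exact: continuous_subspaceT.
have [K [_ hK]] := compact_bounded cU.
exists (K + 1) => x Ux; apply: hK; first by rewrite ltrDl.
by exists x.
Qed.

Section finite_measure.
Variable mu : {finite_measure set (measurableTypeR R) -> \bar R}.

Lemma continuous_integrable h : continuous h -> mu.-integrable U (EFin \o h).
Proof.
move=> ch; have [K hK] := continuous_bounded ch.
apply: measurable_bounded_integrable => //.
- by rewrite ltey_eq fin_num_measure.
- exact: measurable_funTS (continuous_measurable_fun ch).
- exists K; split; first exact: num_real.
  by move=> L KL x Ux; apply: le_trans (hK _ Ux) (ltW KL).
Qed.

Lemma cell_integrable h M m :
  mu.-integrable U (fun x => (h (node M m) * \1_(cell M m) x)%:E).
Proof.
rewrite (_ : (fun x => _) =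
  (fun x => (h (node M m))%:E * (\1_(cell M m) x)%:E)%E) //.
apply: integrableZl => //; apply: (@integrableS _ _ _ _ setT) => //.
by apply: integrable_indic; exact: measurable_cell.
Qed.

Lemma Rintegral_step h M : \int[mu]_(x in U) step_fun h M x =
  \sum_(m < (2 * M.+1).+1) h (node M m) * fine (mu (cell M m `&` U)).
Proof.
rewrite /Rintegral /step_fun.
under eq_integral do rewrite -sumEFin.
rewrite integral_sum//=; last by move=> m; exact: cell_integrable.
rewrite (eq_bigr (fun m : 'I_(2 * M.+1).+1 =>
    (h (node M m) * fine (mu (cell M m `&` U)))%:E)) ?sumEFin// => m _.
have mC : measurable (cell M m) by exact: measurable_cell.
transitivity (\int[mu]_(x in U) ((h (node M m))%:E * (\1_(cell M m) x)%:E))%E => //.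
rewrite integralZl//; last first.
  by apply: (@integrableS _ _ _ _ setT) => //; exact: integrable_indic.
by rewrite integral_indic// EFinM fineK// fin_num_measure//; exact: measurableI.
Qed.

Lemma Rintegral_step_cvg h : continuous h ->
  \int[mu]_(x in U) step_fun h M x @[M --> \oo] --> \int[mu]_(x in U) h x.
Proof.
move=> ch; have [K hK] := continuous_bounded ch.
have [] := @dominated_convergence _ _ _ mu U _
  (fun M x => (step_fun h M x)%:E) (EFin \o h) (cst K%:E).
- exact: measurable_itv.
- move=> M; apply/measurable_EFinP; apply: measurable_sum => m.
  apply: measurable_funM => //.
  by apply: measurable_indic; exact: measurable_cell.
- apply/measurable_EFinP; exact: measurable_funTS (continuous_measurable_fun ch).
- apply: aeW => x Ux; apply/cvg_EFin; first by near=> M.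
  have -> : fine \o (fun M => (step_fun h M x)%:E) = (fun M => h (node_below M x)).
    by apply/funext => M /=; rewrite step_funE.
  apply: (continuous_cvg _ (ch x)); apply: node_below_cvg.
  by move: Ux; rewrite /= in_itv/= => /andP[].
- exact: finite_measure_integrable_cst.
- apply: aeW => x M Ux; rewrite lee_fin step_funE// hK//.
  move: Ux; rewrite /= !in_itv/= => /andP[x1 x2]; rewrite node_ge/=.
  by have /andP[_ /le_trans] := node_below_itv M x1; apply.
move=> _ _ hcvg; apply: fine_cvg.
rewrite fineK//.
by apply: integrable_fin_num => //; exact: continuous_integrable.
Unshelve. all: by end_near. Qed.

End finite_measure.

(** The integral against a charge depends only on the values of the charge, not on
    the Hahn decomposition used to define it; symmetry and positivity of a
    weight matrix therefore pass from Borel sets to continuous functions. *)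
Lemma charge_integral_step_cvg
    (nu : {charge set (measurableTypeR R) -> \bar R}) h : continuous h ->
  \sum_(m < (2 * M.+1).+1) h (node M m) * fine (nu (cell M m `&` U)) @[M --> \oo]
    --> charge_integral nu U h.
Proof.
move=> ch; set P := jordan_pos (hahn_setsP nu); set N := jordan_neg (hahn_setsP nu).
have -> : (fun M => \sum_(m < (2 * M.+1).+1) h (node M m) * fine (nu (cell M m `&` U)))
   = (fun M => \int[P]_(x in U) step_fun h M x - \int[N]_(x in U) step_fun h M x).
  apply/funext => M; rewrite !Rintegral_step -sumrB; apply: eq_bigr => m _.
  have mC : measurable (cell M m `&` U).
    by apply: measurableI => //; exact: measurable_cell.
  rewrite -mulrBr (jordan_decomp (hahn_setsP nu) mC) /cadd/= cscaleN1.
  by rewrite fineD ?fineN ?fin_numN ?fin_num_measure.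
by apply: cvgB; exact: Rintegral_step_cvg.
Qed.
End step_approximation.

(** * Positive forms on continuous functions *)

Section continuous_functionals.
Context (R : realType).
Local Notation U := (`[-1, 1]%classic : set (measurableTypeR R)).

Definition continuous_linear (l : (R -> R) -> R) : Prop :=
  forall (t : R) (f g : R -> R), continuous f -> continuous g ->
    l (fun x => t * f x + g x) = t * l f + l g.

Lemma continuous_lin (t : R) (f g : R -> R) : continuous f -> continuous g ->
  continuous (fun x => t * f x + g x).
Proof.
by move=> cf cg x; apply: cvgD; [apply: cvgM; [exact: cvg_cst|exact: cf]|exact: cg].
Qed.

Lemma continuous_prod (f g : R -> R) : continuous f -> continuous g ->
  continuous (fun x => f x * g x).
Proof. by move=> cf cg x; apply: cvgM; [exact: cf|exact: cg]. Qed.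

Lemma cts_zero : continuous (fun _ : R => 0 : R).
Proof. by move=> x; exact: cvg_cst. Qed.

Lemma functional0 l : continuous_linear l -> l (fun _ => 0) = 0.
Proof.
move=> ll; have := ll 1 _ _ cts_zero cts_zero.
under eq_fun do rewrite mulr0 addr0.
by rewrite mul1r -[LHS]addr0 => /addrI.
Qed.

Lemma Rintegral_linear (mu : {finite_measure set (measurableTypeR R) -> \bar R}) :
  continuous_linear (fun f => \int[mu]_(x in U) f x).
Proof.
move=> t f g cf cg; rewrite RintegralD//.
- by rewrite RintegralZl//; exact: continuous_integrable.
- apply: continuous_integrable; apply: continuous_prod => //.
  by move=> x; exact: cvg_cst.
- exact: continuous_integrable.
Qed.

Lemma charge_integral_linear (nu : {charge set (measurableTypeR R) -> \bar R}) :
  continuous_linear (charge_integral nu U).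
Proof.
by move=> t f g cf cg; rewrite /charge_integral !Rintegral_linear//; ring.
Qed.

Lemma Rintegral_null_setC (mu : {finite_measure set (measurableTypeR R) -> \bar R})
    (f : R -> R) : continuous f -> mu (~` U) = 0%E ->
  \int[mu]_x f x = \int[mu]_(x in U) f x.
Proof.
move=> cf muU; rewrite [RHS]Rintegral_mkcond; congr fine.
apply: ae_eq_integral => //.
- by apply/measurable_EFinP; exact: continuous_measurable_fun.
- apply/measurable_EFinP/(measurable_restrictT _ _).1 => //.
  exact: measurable_funTS (continuous_measurable_fun cf).
exists (~` U); split => //; first exact: measurableC.
move=> x /= h Ux; apply: h => _; rewrite patchE mem_set//.
Qed.

(** What is used of a weight matrix: integration of continuous functions on
    [-1, 1], with the semi-inner product that it defines on vector functions. *)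
Record positive_form r (L : 'I_r -> 'I_r -> (R -> R) -> R) : Prop := PositiveForm {
  form_linear : forall i j, continuous_linear (L i j);
  form_sym : forall i j (f : R -> R), continuous f -> L i j f = L j i f;
  form_ge0 : forall F : 'I_r -> R -> R, (forall i, continuous (F i)) ->
    0 <= \sum_i \sum_j L i j (fun x => F i x * F j x) }.

Lemma weight_positive_form r
    (W : 'I_r -> 'I_r -> {charge set (measurableTypeR R) -> \bar R}) :
  weight_matrix W -> positive_form (fun i j => charge_integral (W i j) U).
Proof.
move=> [Wpsd _].
have mC M m : measurable (cell M m `&` U : set (measurableTypeR R)).
  by apply: measurableI => //; exact: measurable_cell.
split.
- by move=> i j; exact: charge_integral_linear.
- move=> i j f cf; have h1 := charge_integral_step_cvg (nu := W i j) cf.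
  have h2 := charge_integral_step_cvg (nu := W j i) cf.
  have Wsym M m : W i j (cell M m `&` U) = W j i (cell M m `&` U).
    have [Wt _] := Wpsd _ (mC M m).
    have Wij := congr1 (fun A : 'M[R]_r => A j i) Wt.
    move: Wij; rewrite !mxE => Wij.
    by rewrite -[LHS]fineK ?fin_num_measure// Wij fineK ?fin_num_measure.
  have sumE : (fun M => \sum_(m < (2 * M.+1).+1)
       f (node R M m) * fine (W i j (cell M m `&` U)))
    = (fun M => \sum_(m < (2 * M.+1).+1)
       f (node R M m) * fine (W j i (cell M m `&` U))).
    by apply/funext => M; apply: eq_bigr => m _; rewrite Wsym.
  by rewrite sumE in h1; exact: (cvg_unique _ h1 h2).
- move=> F cF.
  have hcvg : \sum_i \sum_j (\sum_(m < (2 * M.+1).+1)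
      F i (node R M m) * F j (node R M m) * fine (W i j (cell M m `&` U))) @[M --> \oo]
    --> \sum_i \sum_j charge_integral (W i j) U (fun x => F i x * F j x).
    apply: cvg_big => [|i _]; first exact: add_continuous.
    apply: cvg_big => [|j _]; first exact: add_continuous.
    by apply: (@charge_integral_step_cvg _ _ (fun x => F i x * F j x));
      exact: continuous_prod.
  apply: (cvgr_to_ge hcvg); near=> M.
  under eq_bigr do rewrite exchange_big/=.
  rewrite exchange_big/=; apply: sumr_ge0 => m _.
  have [_ /(_ (\col_i F i (node R M m)))] := Wpsd _ (mC M m).
  congr (0 <= _); rewrite !mxE exchange_big/=; apply: eq_bigr => j _.
  rewrite !mxE mulr_suml; apply: eq_bigr => i _; rewrite !mxE; ring.
Unshelve. all: by end_near. Qed.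
End continuous_functionals.

(** * The Cauchy kernel and functions of the second kind *)

Section cauchy_kernel.
Context (R : realType).
Variable z : R[i].
Local Notation x0 := (complex.Re z).
Local Notation y0 := (complex.Im z).
Hypothesis y0_neq0 : y0 != 0.

Definition re_kernel (x : R) : R := complex.Re ((x%:C - z)^-1).
Definition im_kernel (x : R) : R := complex.Im ((x%:C - z)^-1).

Let D_gt0 x : 0 < (x - x0) ^+ 2 + y0 ^+ 2.
Proof. by rewrite ltr_wpDl ?sqr_ge0// exprn_even_gt0. Qed.

Lemma re_kernelE x : re_kernel x = (x - x0) / ((x - x0) ^+ 2 + y0 ^+ 2).
Proof. by rewrite /re_kernel; case: z => a b /=; rewrite sub0r sqrrN. Qed.

Lemma im_kernelE x : im_kernel x = y0 / ((x - x0) ^+ 2 + y0 ^+ 2).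
Proof.
by rewrite /im_kernel; case: z => a b /=; rewrite sub0r sqrrN mulNr opprK.
Qed.

Let cts_invD : continuous (fun x => ((x - x0) ^+ 2 + y0 ^+ 2)^-1).
Proof.
move=> x; apply: cvgV; first by rewrite gt_eqF.
apply: cvgD; last exact: cvg_cst.
have h : (y - x0) @[y --> x] --> x - x0 by apply: cvgB; [exact: cvg_id|exact: cvg_cst].
by rewrite expr2; under eq_fun do rewrite expr2; exact: cvgM.
Qed.

Lemma continuous_re_kernel : continuous re_kernel.
Proof.
rewrite (funext re_kernelE).
move=> x; apply: cvgM; last exact: cts_invD.
by apply: cvgB; [exact: cvg_id|exact: cvg_cst].
Qed.

Lemma continuous_im_kernel : continuous im_kernel.
Proof.
rewrite (funext im_kernelE).
by move=> x; apply: cvgM; [exact: cvg_cst|exact: cts_invD].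
Qed.

(** This and [mulX_im_kernel] are the real and imaginary parts of
    x / (x - z) = 1 + z / (x - z). *)
Lemma mulX_re_kernel x : x * re_kernel x = 1 + x0 * re_kernel x - y0 * im_kernel x.
Proof. by rewrite re_kernelE im_kernelE; field; rewrite gt_eqF. Qed.

Lemma mulX_im_kernel x : x * im_kernel x = x0 * im_kernel x + y0 * re_kernel x.
Proof. by rewrite re_kernelE im_kernelE; field; rewrite gt_eqF. Qed.
End cauchy_kernel.

Section pairing.
Context (R : realType).
Local Notation U := (`[-1, 1]%classic : set (measurableTypeR R)).
Variable l : (R -> R) -> R.
Hypothesis ll : continuous_linear l.

Definition pairing (h : R -> R) (p : {poly R}) : R := l (fun x => p.[x] * h x).

Lemma continuous_pairing_arg (h : R -> R) (p : {poly R}) : continuous h ->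
  continuous (fun x => p.[x] * h x).
Proof. by move=> ch; apply: continuous_prod => //; exact: continuous_horner. Qed.

Lemma pairing_lin h t p q : continuous h ->
  pairing h (t *: p + q) = t * pairing h p + pairing h q.
Proof.
move=> ch; rewrite /pairing -ll; do 1?exact: continuous_pairing_arg.
by congr l; apply/funext => x; rewrite hornerD hornerZ; ring.
Qed.

Lemma pairing0 h : pairing h 0 = 0.
Proof.
rewrite /pairing -[RHS](functional0 ll); congr l; apply/funext => x.
by rewrite horner0 mul0r.
Qed.

Lemma pairingD h p q : continuous h ->
  pairing h (p + q) = pairing h p + pairing h q.
Proof. by move=> ch; rewrite -[p in LHS]scale1r pairing_lin// mul1r. Qed.

Lemma pairingZ h t p : continuous h -> pairing h (t *: p) = t * pairing h p.
Proof. by move=> ch; rewrite -[t *: p]addr0 pairing_lin// pairing0 addr0. Qed.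

Lemma pairing_mulX_re z p : complex.Im z != 0 ->
  pairing (re_kernel z) ('X * p) = l (horner p)
    + complex.Re z * pairing (re_kernel z) p
    - complex.Im z * pairing (im_kernel z) p.
Proof.
move=> yz; have cr := continuous_re_kernel yz; have ci := continuous_im_kernel yz.
have cpr := continuous_pairing_arg (p := p) cr; have cpi := continuous_pairing_arg (p := p) ci.
transitivity (complex.Re z * pairing (re_kernel z) p
  + (- complex.Im z * pairing (im_kernel z) p + l (horner p))); last by ring.
rewrite /pairing -ll//; last exact: continuous_horner.
rewrite -ll//; last by apply: continuous_lin => //; exact: continuous_horner.
congr l; apply/funext => x; rewrite hornerM hornerX.
by rewrite mulrAC mulX_re_kernel//; ring.
Qed.

Lemma pairing_mulX_im z p : complex.Im z != 0 ->
  pairing (im_kernel z) ('X * p) = complex.Re z * pairing (im_kernel z) p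
    + complex.Im z * pairing (re_kernel z) p.
Proof.
move=> yz; have cr := continuous_re_kernel yz; have ci := continuous_im_kernel yz.
have cpr := continuous_pairing_arg (p := p) cr; have cpi := continuous_pairing_arg (p := p) ci.
rewrite addrC -(pairingZ _ _ ci) /pairing -ll//; last by apply: continuous_pairing_arg.
congr l; apply/funext => x; rewrite hornerM hornerX hornerZ.
by rewrite mulrAC mulX_im_kernel//; ring.
Qed.
End pairing.

Section matrix_pairing.
Context (R : realType) (r : nat) (L : 'I_r -> 'I_r -> (R -> R) -> R).
Hypothesis Lform : positive_form L.
Let Llin i j : continuous_linear (L i j) := form_linear Lform i j.

(** For L given by a weight matrix W, the integral of h(x) Q(x) dW(x). *)
Definition mxpairing (h : R -> R) (Q : 'M[{poly R}]_r) : 'M[R]_r :=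
  \matrix_(i, j) \sum_k pairing (L k j) h (Q i k).

Lemma mxpairingD h P Q : continuous h ->
  mxpairing h (P + Q) = mxpairing h P + mxpairing h Q.
Proof.
move=> ch; apply/matrixP => i j; rewrite !mxE -big_split/=.
by apply: eq_bigr => k _; rewrite mxE pairingD.
Qed.

Lemma mxpairing0 h : mxpairing h 0 = 0.
Proof.
by apply/matrixP => i j; rewrite !mxE big1// => k _; rewrite mxE pairing0.
Qed.

Lemma mxpairingM h A Q : continuous h ->
  mxpairing h (map_mx polyC A *m Q) = A *m mxpairing h Q.
Proof.
move=> ch; apply/matrixP => i j; rewrite !mxE.
under [RHS]eq_bigr do rewrite mxE mulr_sumr.
rewrite exchange_big/=; apply: eq_bigr => k _; rewrite mxE.
elim/big_rec2: _ => [|m p t _ <-]; first by rewrite pairing0.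
by rewrite mxE mul_polyC pairing_lin.
Qed.

Lemma mxpairing_mulX_re z Q : complex.Im z != 0 ->
  mxpairing (re_kernel z) ('X *: Q) = mxpairing (fun=> 1) Q
    + complex.Re z *: mxpairing (re_kernel z) Q
    - complex.Im z *: mxpairing (im_kernel z) Q.
Proof.
move=> yz; apply/matrixP => i j; rewrite !mxE !mulr_sumr -big_split/= -sumrB.
apply: eq_bigr => k _; rewrite mxE pairing_mulX_re//; congr (_ + _ - _).
by rewrite /pairing; congr (L k j); apply/funext => x; rewrite mulr1.
Qed.

Lemma mxpairing_mulX_im z Q : complex.Im z != 0 ->
  mxpairing (im_kernel z) ('X *: Q) = complex.Re z *: mxpairing (im_kernel z) Q
    + complex.Im z *: mxpairing (re_kernel z) Q.
Proof.
move=> yz; apply/matrixP => i j; rewrite !mxE !mulr_sumr -big_split/=.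
by apply: eq_bigr => k _; rewrite mxE pairing_mulX_im.
Qed.

(** Bessel's inequality for the vector-valued polynomials in row i of the Q_n,
    tested on h times the j-th basis vector. *)
Lemma mxpairing_l2 (Q : nat -> 'M[{poly R}]_r) (p : nat -> R) i j h :
  continuous h -> (forall n, 0 < p n) ->
  (forall n m, \sum_k \sum_l L k l (fun x => (Q n i k).[x] * (Q m i l).[x])
     = if n == m then (p n)^-1 else 0) ->
  weighted_l2 p (fun n => mxpairing h (Q n) i j).
Proof.
move=> ch p0 orth.
pose V := 'I_r -> R -> R.
pose B (F G : V) := \sum_k \sum_l L k l (fun x => F k x * G l x).
pose f : V := fun k x => if k == j then h x else 0.
pose e n : V := fun k x => (Q n i k).[x].
pose D (F : V) := forall k, continuous (F k).
exists (B f f) => M.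
have De n : D (e n) by move=> k; exact: continuous_horner.
have Df : D f.
  by move=> k; rewrite /f; case: eqP => _ //; exact: cts_zero.
have -> : \sum_(n < M) p n * mxpairing h (Q n) i j ^+ 2
   = \sum_(n < M) p n * B (e n) f ^+ 2.
  apply: eq_bigr => n _; congr (_ * _ ^+ 2); rewrite mxE; apply: eq_bigr => k _.
  rewrite (bigD1 j)//= big1 ?addr0 => [|l lj].
    by congr (L k j); apply/funext => x; rewrite /f eqxx.
  rewrite -[RHS](functional0 (Llin k l)); congr (L k l); apply/funext => x.
  by rewrite /f (negbTE lj) mulr0.
apply: (@bessel_inequality _ V D B) => //.
- by move=> t F G cF cG k; exact: continuous_lin.
- move=> t F G H cF cG cH; rewrite /B mulr_sumr -big_split/=.
  apply: eq_bigr => k _; rewrite mulr_sumr -big_split/=; apply: eq_bigr => l _.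
  rewrite -Llin; do 1?exact: continuous_prod.
  congr (L k l); apply/funext => x; rewrite -[(t *: F + G) k x]/(t * F k x + G k x).
  ring.
- move=> F G cF cG; rewrite /B exchange_big/=; apply: eq_bigr => k _.
  apply: eq_bigr => l _; rewrite (form_sym Lform); last exact: continuous_prod.
  by congr (L k l); apply/funext => x; rewrite mulrC.
- by move=> F cF; exact: (form_ge0 Lform).
Qed.
End matrix_pairing.

(** * Proportionality of the solutions on a leg *)

Section resolvent_solutions.
Context (R : realType).

(** The last condition is detailed balance: p is a reversible measure. The bounds
    by 1 let the weighted squares control the boundary term of
    [green_identity]. *)
Definition reversible_rates (a c p : nat -> R) : Prop :=
  [/\ forall n, 0 < p n, forall n, 0 < a n <= 1, forall n, c n.+1 <= 1
    & forall n, p n * a n = p n.+1 * c n.+1].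

Lemma resolvent_eqB (a b c : nat -> R) x y s t s1 t1 u v u1 v1 :
  resolvent_eq a b c x y s t u v -> resolvent_eq a b c x y s1 t1 u1 v1 ->
  resolvent_eq a b c x y (s - s1) (t - t1)
    (fun n => u n + -1 * u1 n) (fun n => v n + -1 * v1 n).
Proof.
move=> h h1 n; have [e1 e2] := h n; have [e3 e4] := h1 n.
move: e1 e2 e3 e4; rewrite /jacobi_step; case: n => [|n]/= e1 e2 e3 e4; lra.
Qed.

Variables (a b c p : nat -> R) (x y : R).
Hypothesis rates : reversible_rates a c p.
Hypothesis y_neq0 : y != 0.

Let rates_uniqueness s t u v : resolvent_eq a b c x y s t u v ->
  weighted_l2 p u -> weighted_l2 p v -> u 0%N * t - v 0%N * s = 0 ->
  forall n, u n = 0 /\ v n = 0.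
Proof.
case: rates => p0 a01 c1 bal; apply: jacobi_uniqueness => // n.
- by have /andP[/ltW] := a01 n.
- by have /andP[_] := a01 n.
Qed.

(** If f_0 = 0 then uniqueness forces f = 0, against (J - z) f = delta_0. *)
Lemma resolvent_at0_neq0 u v : resolvent_eq a b c x y 1 0 u v ->
  weighted_l2 p u -> weighted_l2 p v -> u 0%N +i* v 0%N != 0.
Proof.
move=> h hu hv; apply/eqP => -[u0 v0].
have uv := rates_uniqueness h hu hv.
have [e _] := h 0%N; move: e.
have {}uv : forall n, u n = 0 /\ v n = 0 by apply: uv; rewrite u0 v0; ring.
rewrite /jacobi_step (uv 1%N).1 (uv 0%N).1 (uv 0%N).2/=.
by move=> /eqP; rewrite !mulr0 subr0 !add0r eq_sym oner_eq0.
Qed.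

(** The difference of f and (s + it) f1 is square summable with source zero. *)
Lemma resolvent_at0_proportional s t u v u1 v1 :
  resolvent_eq a b c x y s t u v -> weighted_l2 p u -> weighted_l2 p v ->
  resolvent_eq a b c x y 1 0 u1 v1 -> weighted_l2 p u1 -> weighted_l2 p v1 ->
  u 0%N +i* v 0%N = (s +i* t) * (u1 0%N +i* v1 0%N).
Proof.
move=> h hu hv h1 hu1 hv1.
have p0 : forall n, 0 < p n by case: rates.
have h2 : resolvent_eq a b c x y s t (fun n => s * u1 n + - t * v1 n)
    (fun n => s * v1 n + t * u1 n).
  move=> n; have [e1 e2] := h1 n; move: e1 e2; rewrite /jacobi_step.
  set U := if n is m.+1 then u1 m else 0; set V := if n is m.+1 then v1 m else 0.
  have -> : (if n is m.+1 then s * u1 m + - t * v1 m else 0) = s * U - t * V.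
    by rewrite /U /V; case: (n) => *; ring.
  have -> : (if n is m.+1 then s * v1 m + t * u1 m else 0) = s * V + t * U.
    by rewrite /U /V; case: (n) => *; ring.
  move=> e1 e2; split.
    transitivity (s * (a n * u1 n.+1 + b n * u1 n + c n * U)
      - t * (a n * v1 n.+1 + b n * v1 n + c n * V)); first by ring.
    by rewrite e1 e2; case: eqP => _; ring.
  transitivity (s * (a n * v1 n.+1 + b n * v1 n + c n * V)
      + t * (a n * u1 n.+1 + b n * u1 n + c n * U)); first by ring.
  by rewrite e1 e2; case: eqP => _; ring.
have l0 : weighted_l2 p (fun=> 0).
  by exists 0 => M; rewrite big1// => n _; rewrite expr0n mulr0.
have lin (w w' : nat -> R) k k' : weighted_l2 p w -> weighted_l2 p w' ->
    weighted_l2 p (fun n => k * w n + k' * w' n).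
  move=> hw hw'; apply: weighted_l2_lin => //.
  have := weighted_l2_lin k p0 l0 hw.
  by under eq_fun do rewrite add0r.
have h3 := resolvent_eqB h h2.
have [] := rates_uniqueness h3 _ _ _ 0%N.
- by apply: weighted_l2_lin => //; exact: lin.
- by apply: weighted_l2_lin => //; exact: lin.
- by rewrite !subrr; ring.
move=> e1 e2; apply/eqP; rewrite eq_complex/=; apply/andP; split; apply/eqP; lra.
Qed.
End resolvent_solutions.

(** * The spectral measure of a leg *)

Section scalar_measure.
Context (R : realType).
Local Notation U := (`[-1, 1]%classic : set (measurableTypeR R)).
Variables (om : probability (measurableTypeR R) R) (q : nat -> {poly R}).
Variables (a b c p : nat -> R).
Hypothesis om_q : orthogonality_measure om q.
Hypothesis q_rec : scalar_recurrence a b c q.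
Hypothesis rates : reversible_rates a c p.

Let I (f : R -> R) : R := \int[om]_(x in U) f x.
Let I_lin : continuous_linear I := Rintegral_linear om.

Let I1 : I (fun=> 1) = 1.
Proof.
have omU : om U = 1%E := proj1 om_q.
by rewrite /I Rintegral_cst// mul1r; exact: (congr1 fine omU).
Qed.

Let q_orth n m : n != m -> pairing I (horner (q m)) (q n) = 0.
Proof. by move=> /eqP nm; exact: (proj2 om_q). Qed.

Let pairing_prev n m : (n <= m)%N -> pairing I (horner (q m)) (Defs.prev q n) = 0.
Proof.
case: n => [|n] nm /=; first by rewrite pairing0.
by rewrite q_orth// ltn_eqF.
Qed.

Let pairing_rec h n : continuous h -> pairing I h ('X * q n) =
  a n * pairing I h (q n.+1) + b n * pairing I h (q n)
  + c n * pairing I h (Defs.prev q n).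
Proof.
by move=> ch; rewrite (proj2 q_rec) !pairingD// !pairingZ.
Qed.

(** Orthogonality is not normalised in the hypothesis; computing the integral of
    x q_n q_{n+1} with either recurrence gives
    a_n |q_{n+1}|^2 = c_{n+1} |q_n|^2, and detailed balance does the rest. *)
Lemma scalar_norm n : pairing I (horner (q n)) (q n) = p 0%N / p n.
Proof.
case: rates => p0 a01 c1 bal.
elim: n => [|n IH].
  rewrite divff ?gt_eqF// /pairing (proj1 q_rec) -[RHS]I1.
  by congr I; apply/funext => x; rewrite hornerC mulr1.
have ch m : continuous (horner (q m)) by exact: continuous_horner.
have e1 := pairing_rec n (ch n.+1); have e2 := pairing_rec n.+1 (ch n).
have : pairing I (horner (q n.+1)) ('X * q n) = pairing I (horner (q n)) ('X * q n.+1).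
  by congr I; apply/funext => x; rewrite !hornerM; ring.
have o1 : pairing I (horner (q n.+1)) (q n) = 0 by rewrite q_orth// ltn_eqF.
have o2 : pairing I (horner (q n)) (q n.+1) = 0 by rewrite q_orth// gtn_eqF.
have o3 : pairing I (horner (q n)) (q n.+2) = 0 by rewrite q_orth// gtn_eqF// ltnW.
rewrite e1 e2 /= IH pairing_prev ?leqnSn// o1 o2 o3.
rewrite !mulr0 !addr0 add0r => e.
have a0 : a n != 0 by have /andP[/gt_eqF ->] := a01 n.
have cE : c n.+1 = p n * a n / p n.+1 by rewrite bal mulrAC divff ?mul1r ?gt_eqF.
apply: (mulfI a0); rewrite e cE; field.
by rewrite !gt_eqF.
Qed.

(** Bessel's inequality, the squared norm of q_n being p_0 / p_n. *)
Lemma scalar_l2 h : continuous h -> weighted_l2 p (fun n => pairing I h (q n)).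
Proof.
move=> ch; case: (rates) => p0 a01 c1 bal.
pose B (f g : R -> R) := I (fun x => f x * g x).
exists (p 0%N * B h h) => M.
rewrite -ler_pdivrMl// mulr_sumr.
have -> : \sum_(n < M) (p 0%N)^-1 * (p n * pairing I h (q n) ^+ 2)
   = \sum_(n < M) (p n / p 0%N) * B (horner (q n)) h ^+ 2.
  by apply: eq_bigr => n _; rewrite /B /pairing; ring.
apply: (@bessel_inequality _ (R -> R) (fun f : R -> R => continuous f) B _ _ _ _
  (fun n => horner (q n)) (fun n => p n / p 0%N)) => //.
- by move=> t f g cf cg; exact: continuous_lin.
- move=> t f g k cf cg ck; rewrite /B -I_lin; do 1?exact: continuous_prod.
  by congr I; apply/funext => x; rewrite -[(t *: f + g) x]/(t * f x + g x); ring.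
- by move=> f g cf cg; congr I; apply/funext => x; rewrite mulrC.
- by move=> f cf; apply: Rintegral_ge0 => x _; rewrite -expr2 sqr_ge0.
- by move=> n; exact: continuous_horner.
- by move=> n; rewrite divr_gt0.
- move=> n m; case: eqVneq => [->|nm]; last exact: q_orth.
  by rewrite invf_div; exact: scalar_norm.
Qed.

Lemma scalar_resolvent_eq z : complex.Im z != 0 ->
  resolvent_eq a b c (complex.Re z) (complex.Im z) 1 0
    (fun n => pairing I (re_kernel z) (q n))
    (fun n => pairing I (im_kernel z) (q n)).
Proof.
move=> yz; have cr := continuous_re_kernel yz; have ci := continuous_im_kernel yz.
have prevE h : forall n, (if n is m.+1 then pairing I h (q m) else 0)
    = pairing I h (Defs.prev q n).
  by case=> [|n]//=; rewrite pairing0.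
have q0 n : I (horner (q n)) = if n == 0%N then 1 else 0.
  have -> : I (horner (q n)) = pairing I (horner (q 0%N)) (q n).
    by congr I; apply/funext => x; rewrite (proj1 q_rec) hornerC mulr1.
  case: eqP => [->|/eqP n0]; last exact: q_orth.
  by rewrite scalar_norm divff// gt_eqF//; case: rates.
move=> n; rewrite /jacobi_step !prevE -!pairing_rec// pairing_mulX_re//.
rewrite pairing_mulX_im// q0.
by split; case: eqP => _; ring.
Qed.

Lemma stieltjes_pairing z : complex.Im z != 0 -> stieltjes om z
  = pairing I (re_kernel z) (q 0%N) +i* pairing I (im_kernel z) (q 0%N).
Proof.
move=> yz; have omC : om (~` U) = 0%E.
  rewrite probability_setC// (_ : om _ = 1%E) ?subee//; exact: (proj1 om_q).
rewrite /stieltjes !Rintegral_null_setC//;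
  [|exact: continuous_im_kernel|exact: continuous_re_kernel].
rewrite (proj1 q_rec) /pairing; congr (_ +i* _); apply: eq_Rintegral => x _;
  by rewrite hornerC mul1r.
Qed.
End scalar_measure.

(** * Rates and reversible weights of the spider *)

Lemma invmx_diag_mx (F : fieldType) n (e : 'rV[F]_n) : (forall j, e 0 j != 0) ->
  invmx (diag_mx e) = diag_mx (\row_j (e 0 j)^-1).
Proof.
move=> e0; set E := diag_mx (\row_j _).
have DE : diag_mx e *m E = 1%:M.
  rewrite /E mulmx_diag; apply/matrixP => i j; rewrite !mxE.
  by case: eqP => [->|_]; rewrite ?mulr1n ?mulr0n// divff.
have [uD _] := mulmx1_unit DE.
by rewrite -[LHS]mulmx1 -DE mulmxA mulVmx// mul1mx.
Qed.

Section spider_matrices.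
Context (R : realType) (N : nat).
Variables (alpha : nat -> R) (a b c : nat -> nat -> R).

Definition body : 'I_(1 + N.-1) := lshift N.-1 ord0.
Definition foot (k : 'I_N.-1) : 'I_(1 + N.-1) := rshift 1 k.

Lemma mul_legs_diag f n (X : 'M[R]_(1 + N.-1)) i j :
  (legs_diag N f n *m X) i j
  = (if i == 0%N :> nat then f n N else f n.+1 i) * X i j.
Proof. by rewrite mul_diag_mx !mxE. Qed.

Lemma mul_blockB0_body (X : 'M[R]_(1 + N.-1)) j :
  (blockB N alpha b c 0 *m X) body j
  = alpha 0%N * X body j + \sum_(k < N.-1) alpha k.+1 * X (foot k) j.
Proof.
rewrite mxE big_split_ord big_ord1/= block_mxEul !mxE eqxx mulr1n.
by congr (_ + _); apply: eq_bigr => k _; rewrite block_mxEur !mxE.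
Qed.

Lemma mul_blockB0_foot (X : 'M[R]_(1 + N.-1)) (k : 'I_N.-1) j :
  (blockB N alpha b c 0 *m X) (foot k) j
  = c 1%N k.+1 * X body j + b 1%N k.+1 * X (foot k) j.
Proof.
rewrite mxE big_split_ord big_ord1/= block_mxEdl !mxE; congr (_ + _).
rewrite (bigD1 k)//= big1 ?addr0 => [|m mk]; rewrite block_mxEdr !mxE.
  by rewrite eqxx mulr1n.
by rewrite eq_sym (negbTE mk) mulr0n mul0r.
Qed.

Hypothesis rates : spider_rates N alpha a b c.

Let c_gt0 k m : (1 <= k)%N -> (1 <= m <= N)%N -> 0 < c k m.
Proof. by case: rates => _ _ _ h k1 m1; case: (h k m k1 m1). Qed.

Let a_gt0 k m : (1 <= k)%N -> (1 <= m <= N)%N -> 0 < a k m.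
Proof. by case: rates => _ _ _ h k1 m1; case: (h k m k1 m1). Qed.

Let alpha_gt0 m : (1 <= m <= N)%N -> 0 < alpha m.
Proof. by case: rates => _ _ h _; exact: h. Qed.

Let a_le1 k m : (1 <= k)%N -> (1 <= m <= N)%N -> a k m <= 1.
Proof.
case: rates => _ _ _ h k1 m1; case: (h k m k1 m1) => s1 a0 b0 c0; lra.
Qed.

Let c_le1 k m : (1 <= k)%N -> (1 <= m <= N)%N -> c k m <= 1.
Proof.
case: rates => _ _ _ h k1 m1; case: (h k m k1 m1) => s1 a0 b0 c0; lra.
Qed.

Let alphaN_le1 : (0 < N)%N -> alpha N <= 1.
Proof.
case: rates => s1 a0 h _ N0; rewrite -s1 big_nat_recr//= lerDr.
rewrite big_seq; apply: sumr_ge0 => -[|i]//.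
by rewrite mem_index_iota => /andP[_ iN]; apply/ltW/h; exact: ltnW.
Qed.

Lemma spider_pi_gt0 n m : (1 <= m <= N)%N -> 0 < spider_pi alpha a c n m.
Proof.
case: n => [|n] mN; first by rewrite /= ltr01.
rewrite /spider_pi divr_gt0// ?mulr_gt0 ?alpha_gt0//;
  rewrite big_seq; apply: prodr_gt0 => i; rewrite mem_index_iota => /andP[i1 _].
- exact: a_gt0.
- exact: c_gt0.
Qed.

Lemma spider_pi_balance n m : (1 <= n)%N -> (1 <= m <= N)%N ->
  spider_pi alpha a c n m * a n m = spider_pi alpha a c n.+1 m * c n.+1 m.
Proof.
case: n => // n _ mN; rewrite /spider_pi.
rewrite [X in _ = _ * X / _ * _](big_nat_recr n.+1 1%N)//=.
rewrite [X in _ = _ / X * _](big_nat_recr n.+2 1%N)//=.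
set C := \prod_(1 <= i < n.+2) c i m.
have C0 : 0 < C.
  rewrite /C big_seq; apply: prodr_gt0 => i; rewrite mem_index_iota => /andP[i1 _].
  exact: c_gt0.
have c0 : 0 < c n.+2 m by exact: c_gt0.
by field; rewrite !gt_eqF.
Qed.

Lemma body_leg_rates : (0 < N)%N -> reversible_rates
  (fun n => up_rate N alpha a n N) (fun n => c n N)
  (fun n => spider_pi alpha a c n N).
Proof.
move=> N0; have NN : (1 <= N <= N)%N by rewrite N0 leqnn.
split=> [n|[|n]|n|[|n]].
- exact: spider_pi_gt0.
- by rewrite /= alpha_gt0// alphaN_le1.
- by rewrite /= a_gt0// a_le1.
- exact: c_le1.
- rewrite /spider_pi/= big_geq// big_nat1 mulr1 mul1r divfK// gt_eqF//.
  exact: c_gt0.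
- exact: spider_pi_balance.
Qed.

Lemma foot_leg_rates m : (1 <= m <= N)%N -> reversible_rates
  (fun n => a n.+1 m) (fun n => c n.+1 m) (fun n => spider_pi alpha a c n.+1 m).
Proof.
move=> mN; split=> n.
- exact: spider_pi_gt0.
- by rewrite a_gt0// a_le1.
- exact: c_le1.
- exact: spider_pi_balance.
Qed.

(** The diagonal of Pi_n; index 0 stands for leg N. *)
Definition site_pi (i : 'I_(1 + N.-1)) n : R :=
  if i == 0%N :> nat then spider_pi alpha a c n N else spider_pi alpha a c n.+1 i.

Lemma site_pi_gt0 i n : (0 < N)%N -> 0 < site_pi i n.
Proof.
move=> N0; rewrite /site_pi; case: eqP => i0; apply: spider_pi_gt0.
  by rewrite N0 leqnn.
apply/andP; split; first by rewrite lt0n; exact/eqP.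
by apply: (leq_trans (ltnW (ltn_ord i))); rewrite add1n prednK.
Qed.

Lemma invmx_blockPi n : (0 < N)%N ->
  invmx (blockPi N alpha a c n) = diag_mx (\row_i (site_pi i n)^-1).
Proof.
move=> N0; rewrite /blockPi /legs_diag invmx_diag_mx => [|i].
  by congr diag_mx; apply/rowP => i; rewrite !mxE.
by rewrite mxE gt_eqF//; exact: site_pi_gt0.
Qed.
End spider_matrices.

(** * Leg-by-leg form of the transition matrix *)

Section spider_rows.
Context (R : realType) (N : nat).
Variables (alpha : nat -> R) (a b c : nat -> nat -> R).
Variable F : nat -> 'M[R]_(1 + N.-1).

(** Row n of the product of the block tridiagonal matrix P with the column of
    blocks F. *)
Definition spider_step n : 'M[R]_(1 + N.-1) :=
  blockA N alpha a n *m F n.+1 + blockB N alpha b c n *m F n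
  + blockC N c n *m Defs.prev F n.

(** The row of P at a site of leg N, body included, is the row of the Jacobi
    operator of that leg, plus, at the body, the jumps to the other legs. *)
Lemma spider_step_body n j : spider_step n (body N) j =
  jacobi_step (fun n => up_rate N alpha a n N) (fun n => stay_rate alpha b n N)
    (fun n => c n N) (fun n => F n (body N) j) n
  + (if n == 0%N then \sum_(k < N.-1) alpha k.+1 * F 0%N (foot k) j else 0).
Proof.
rewrite /spider_step /jacobi_step mxE [X in X + _]mxE.
rewrite /blockA /blockC !mul_legs_diag.
by case: n => [|n]; rewrite ?mul_blockB0_body ?mul_legs_diag/= ?mxE; ring.
Qed.

(** On leg k < N the only interaction with the rest of the spider is the
    jump from the first site to the body. *)
Lemma spider_step_foot n (k : 'I_N.-1) j : spider_step n (foot k) j =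
  jacobi_step (fun n => a n.+1 k.+1) (fun n => b n.+1 k.+1)
    (fun n => c n.+1 k.+1) (fun n => F n (foot k) j) n
  + (if n == 0%N then c 1%N k.+1 * F 0%N (body N) j else 0).
Proof.
rewrite /spider_step /jacobi_step mxE [X in X + _]mxE.
rewrite /blockA /blockC !mul_legs_diag.
by case: n => [|n]; rewrite ?mul_blockB0_foot ?mul_legs_diag/= ?mxE; ring.
Qed.
End spider_rows.

(** * The Green function of the spider *)

Section spider_weight_resolvent.
Context (R : realType) (N : nat).
Local Notation U := (`[-1, 1]%classic : set (measurableTypeR R)).
Variables (alpha : nat -> R) (a b c : nat -> nat -> R).
Variables (Q : nat -> 'M[{poly R}]_(1 + N.-1)).
Variables (W : 'I_(1 + N.-1) -> 'I_(1 + N.-1) ->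
       {charge set (measurableTypeR R) -> \bar R}).
Hypothesis N_gt0 : (0 < N)%N.
Hypothesis rates : spider_rates N alpha a b c.
Hypothesis Q_rec :
  matrix_recurrence (blockA N alpha a) (blockB N alpha b c) (blockC N c) Q.
Hypothesis W_weight : spider_weight alpha a c Q W.

Let L i j (f : R -> R) : R := charge_integral (W i j) U f.
Let L_form : positive_form L.
Proof. by case: W_weight => Ww _ _; exact: weight_positive_form. Qed.

Let W_orth n m i j :
  \sum_k \sum_l L k l (fun x => (Q n i k).[x] * (Q m j l).[x])
  = if (n == m) && (i == j) then (site_pi alpha a c i n)^-1 else 0.
Proof.
case: W_weight => _ _ /(_ n m)/(congr1 (fun A : 'M[R]_(1 + N.-1) => A i j)).
rewrite mxE => orth; transitivity ((if n == m then invmx (blockPi N alpha a c n)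
  else 0) i j).
  rewrite -orth; apply: eq_bigr => k _; apply: eq_bigr => l _.
  by congr (L k l); apply/funext => x; rewrite !mxE.
case: eqP => _; last by rewrite mxE.
by rewrite (invmx_blockPi rates)// !mxE; case: eqP => [->|_].
Qed.

Lemma mxpairing_Q_1 n i j : mxpairing L (fun=> 1) (Q n) i j
  = if (n == 0%N) && (i == j) then (site_pi alpha a c i 0)^-1 else 0.
Proof.
transitivity (if (n == 0%N) && (i == j) then (site_pi alpha a c i n)^-1 else 0);
  last by case: eqP => // ->.
rewrite -W_orth mxE; apply: eq_bigr => k _.
rewrite (proj1 Q_rec) (bigD1 j)//= big1 ?addr0 => [|l lj].
  by congr (L k j); apply/funext => x; rewrite mxE eqxx hornerC.
rewrite -[RHS](functional0 (form_linear L_form k l)); congr (L k l).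
by apply/funext => x; rewrite mxE eq_sym (negbTE lj) horner0 mulr0.
Qed.

Variable z : R[i].
Hypothesis z_nonreal : complex.Im z != 0.
Local Notation x0 := (complex.Re z).
Local Notation y0 := (complex.Im z).

Let cr := continuous_re_kernel z_nonreal.
Let ci := continuous_im_kernel z_nonreal.

(** The real and imaginary parts of U_n(z) = \int Q_n(x) dW(x) / (x - z), which
    satisfies U_n(z) Pi_0 = ((P - z)^{-1})_{n0} in blocks. *)
Definition green_re n := mxpairing L (re_kernel z) (Q n).
Definition green_im n := mxpairing L (im_kernel z) (Q n).

Let green_step h n : continuous h -> mxpairing L h ('X *: Q n)
  = spider_step alpha a b c (fun n => mxpairing L h (Q n)) n.
Proof.
move=> ch; rewrite (proj2 Q_rec) !mxpairingD// !mxpairingM//.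
by congr (_ + _ *m _); case: n => [|n]//=; rewrite mxpairing0.
Qed.

Lemma green_l2 i j h : continuous h ->
  weighted_l2 (site_pi alpha a c i) (fun n => mxpairing L h (Q n) i j).
Proof.
move=> ch; apply: mxpairing_l2 => // [n|n m]; first exact: (site_pi_gt0 rates).
by rewrite W_orth eqxx andbT.
Qed.

Definition source (i j : 'I_(1 + N.-1)) : R :=
  if i == j then (site_pi alpha a c i 0)^-1 else 0.

Let green_step_re n i j : spider_step alpha a b c green_re n i j
  = x0 * green_re n i j - y0 * green_im n i j + (if n == 0%N then source i j else 0).
Proof.
rewrite -green_step// mxpairing_mulX_re//.
have entryE (A B C : 'M[R]_(1 + N.-1)) :
  (A + x0 *: B - y0 *: C) i j = A i j + x0 * B i j - y0 * C i j by rewrite !mxE.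
by rewrite entryE mxpairing_Q_1 /source; case: (n == 0%N) => /=; ring.
Qed.

Let green_step_im n i j : spider_step alpha a b c green_im n i j
  = x0 * green_im n i j + y0 * green_re n i j.
Proof.
rewrite -green_step// mxpairing_mulX_im//.
by rewrite mxE; congr (_ + _); rewrite mxE.
Qed.

Lemma body_leg_resolvent j :
  resolvent_eq (fun n => up_rate N alpha a n N) (fun n => stay_rate alpha b n N)
    (fun n => c n N) x0 y0
    (source (body N) j - \sum_(k < N.-1) alpha k.+1 * green_re 0 (foot k) j)
    (- \sum_(k < N.-1) alpha k.+1 * green_im 0 (foot k) j)
    (fun n => green_re n (body N) j) (fun n => green_im n (body N) j).
Proof.
move=> n; have := green_step_re n (body N) j; have := green_step_im n (body N) j.
rewrite !spider_step_body => e1 e2; move: e1 e2.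
by case: (n == 0%N) => e1 e2; split; lra.
Qed.

Lemma foot_leg_resolvent (k : 'I_N.-1) j :
  resolvent_eq (fun n => a n.+1 k.+1) (fun n => b n.+1 k.+1)
    (fun n => c n.+1 k.+1) x0 y0
    (source (foot k) j - c 1%N k.+1 * green_re 0 (body N) j)
    (- (c 1%N k.+1 * green_im 0 (body N) j))
    (fun n => green_re n (foot k) j) (fun n => green_im n (foot k) j).
Proof.
move=> n; have := green_step_re n (foot k) j; have := green_step_im n (foot k) j.
rewrite !spider_step_foot => e1 e2; move: e1 e2.
by case: (n == 0%N) => e1 e2; split; lra.
Qed.

(** The Jordan parts of W_{ij} inherit its support: each is, up to sign, the
    restriction of W_{ij} to a Hahn set. *)
Lemma charge_integral_supported i j (f : R -> R) : continuous f ->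
  charge_integral (W i j) setT f = L i j f.
Proof.
case: W_weight => _ Wsupp _ cf; rewrite /L /charge_integral.
have mU : measurable (~` U) by apply: measurableC; exact: measurable_itv.
have [[mP _] [mN _] _ _] := hahn_setsP (W i j).
have pos0 : jordan_pos (hahn_setsP (W i j)) (~` U) = 0%E.
  rewrite jordan_posE cjordan_posE /crestr0 mem_set// /crestr Wsupp//.
    exact: measurableI.
  by rewrite setIAC setICl set0I.
have neg0 : jordan_neg (hahn_setsP (W i j)) (~` U) = 0%E.
  rewrite jordan_negE cjordan_negE /crestr0 mem_set// /crestr Wsupp ?oppe0//.
    exact: measurableI.
  by rewrite setIAC setICl set0I.
by rewrite !Rintegral_null_setC.
Qed.

(** Because Q_0 is the identity. *)
Lemma mx_stieltjes_green i j :
  mx_stieltjes W z i j = green_re 0 i j +i* green_im 0 i j.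
Proof.
rewrite mxE /charge_stieltjes !charge_integral_supported//.
have Q0E h : continuous h -> mxpairing L h (Q 0%N) i j = L i j h.
  move=> ch; rewrite mxE (bigD1 i)//= big1 ?addr0 => [|k ki].
    by congr (L i j); apply/funext => x; rewrite (proj1 Q_rec) mxE eqxx hornerC mul1r.
  rewrite (proj1 Q_rec) mxE eq_sym (negbTE ki).
  by rewrite pairing0//; exact: form_linear.
by rewrite /green_re /green_im !Q0E.
Qed.
End spider_weight_resolvent.

(** * Solving for the Stieltjes transform *)

Lemma sum_complex (R : realType) (I : Type) (s : seq I) (f g : I -> R) :
  (\sum_(k <- s) f k) +i* (\sum_(k <- s) g k) = \sum_(k <- s) (f k +i* g k) :> R[i].
Proof.
elim: s => [|k s IH]; first by rewrite !big_nil.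
by rewrite !big_cons -IH.
Qed.

Lemma complex_scaleE (R : realType) (t u v : R) :
  (t * u) +i* (t * v) = t%:C * (u +i* v) :> R[i].
Proof. by apply/eqP; rewrite eq_complex/= !mul0r subr0 addr0 !eqxx. Qed.

Lemma complex_subE (R : realType) (s u v : R) :
  (s - u) +i* (- v) = s%:C - (u +i* v) :> R[i].
Proof. by apply/eqP; rewrite eq_complex/= sub0r !eqxx. Qed.

Theorem proposition2p4 (R : realType) (N : nat) (hN : (0 < N)%N)
  (alpha : nat -> R) (a b c : nat -> nat -> R)
  (hrates : spider_rates N alpha a b c)
  (d : measure_display) (T : measurableType d) (Pr : probability T R)
  (S : nat -> T -> R[i]) (hS : spider_chain Pr N alpha a b c S)
  (Q : nat -> 'M[{poly R}]_(1 + N.-1))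
  (hQ : matrix_recurrence (blockA N alpha a) (blockB N alpha b c) (blockC N c) Q)
  (W : 'I_(1 + N.-1) -> 'I_(1 + N.-1) ->
       {charge set (measurableTypeR R) -> \bar R})
  (hW : spider_weight alpha a c Q W)
  (q : nat -> nat -> {poly R})
  (hqN : scalar_recurrence (fun n => up_rate N alpha a n N)
           (fun n => stay_rate alpha b n N) (fun n => c n N) (q N))
  (hq : forall k, (1 <= k <= N.-1)%N ->
     scalar_recurrence (fun n => a n.+1 k) (fun n => b n.+1 k)
       (fun n => c n.+1 k) (q k))
  (omega : nat -> probability (measurableTypeR R) R)
  (homega : forall k, (1 <= k <= N)%N -> orthogonality_measure (omega k) (q k))
  (z : R[i]) (hz : complex.Im z != 0) :
  let BD := diag_stieltjes N omega z in
  let alphaD := diag_mx (toC_mx (alpha_vec N alpha))^T in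
  let cD := diag_mx (toC_mx (c_vec N c))^T in
  let cv := toC_mx (c_vec N c) in
  mx_stieltjes W z =
    block_mx 0 0
             0          (BD *m cD *m invmx alphaD)
    + spider_b N alpha c omega z *:
      block_mx 1%:M       (- (cv^T *m BD))
               (- (BD *m cv))   (BD *m cv *m cv^T *m BD).
Proof.
move=> BD alphaD cD cv.
have NN : (1 <= N <= N)%N by rewrite hN leqnn.
have kN (k : 'I_N.-1) : (1 <= k.+1 <= N.-1)%N by rewrite /= ltn_ord.
have kN' (k : 'I_N.-1) : (1 <= k.+1 <= N)%N.
  by rewrite /= (leq_trans (ltn_ord k))// leq_pred.
(* The equations of the body and of the first site of each leg, by comparison
   with the scalar solution on the leg. *)
pose beta (k : 'I_N.-1) := stieltjes (omega k.+1) z.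
pose betaN := stieltjes (omega N) z.
pose F := mx_stieltjes W z.
pose src := @source R N alpha a c.
have cr := continuous_re_kernel hz; have ci := continuous_im_kernel hz.
have ratesN := body_leg_rates hrates hN.
have eqN := scalar_resolvent_eq (homega _ NN) hqN ratesN hz.
have l2N h := scalar_l2 (homega _ NN) hqN ratesN (h := h).
have betaN_neq0 : betaN != 0.
  rewrite /betaN (stieltjes_pairing (homega _ NN) hqN hz).
  by apply: (resolvent_at0_neq0 ratesN hz eqN); exact: l2N.
have Fbody j : F (body N) j =
    ((src (body N) j)%:C - \sum_(k < N.-1) (alpha k.+1)%:C * F (foot k) j) * betaN.
  rewrite /F (mx_stieltjes_green hQ hW hz).
  have eqW := body_leg_resolvent hN hrates hQ hW hz j.
  rewrite (resolvent_at0_proportional ratesN hz eqW _ _ eqN).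
  - rewrite -(stieltjes_pairing (homega _ NN) hqN hz); congr (_ * _).
    rewrite complex_subE sum_complex; congr (_ - _); apply: eq_bigr => k _.
    by rewrite complex_scaleE -(mx_stieltjes_green hQ hW hz).
  - exact: (green_l2 hN hrates hW (body N) j cr).
  - exact: (green_l2 hN hrates hW (body N) j ci).
  - exact: l2N.
  - exact: l2N.
have Ffoot k j : F (foot k) j =
    ((src (foot k) j)%:C - (c 1%N k.+1)%:C * F (body N) j) * beta k.
  have ratesk := foot_leg_rates hrates (kN' k).
  have eqk := scalar_resolvent_eq (homega _ (kN' k)) (hq _ (kN k)) ratesk hz.
  have l2k h := scalar_l2 (homega _ (kN' k)) (hq _ (kN k)) ratesk (h := h).
  rewrite /F (mx_stieltjes_green hQ hW hz).
  have eqW := foot_leg_resolvent hN hrates hQ hW hz k j.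
  rewrite (resolvent_at0_proportional ratesk hz eqW _ _ eqk).
  - rewrite -(stieltjes_pairing (homega _ (kN' k)) (hq _ (kN k)) hz); congr (_ * _).
    by rewrite complex_subE complex_scaleE -(mx_stieltjes_green hQ hW hz).
  - exact: (green_l2 hN hrates hW (foot k) j cr).
  - exact: (green_l2 hN hrates hW (foot k) j ci).
  - exact: l2k.
  - exact: l2k.
(* Eliminating the first sites of the legs. *)
pose tau := \sum_(k < N.-1) (alpha k.+1)%:C * beta k * (c 1%N k.+1)%:C.
have Fsolve j : F (body N) j * (1 / betaN - tau) =
    (src (body N) j)%:C
    - \sum_(k < N.-1) (alpha k.+1)%:C * beta k * (src (foot k) j)%:C.
  have sumE : \sum_(k < N.-1) (alpha k.+1)%:C * F (foot k) j =
      \sum_(k < N.-1) (alpha k.+1)%:C * beta k * (src (foot k) j)%:C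
      - F (body N) j * tau.
    by rewrite mulr_sumr -sumrB; apply: eq_bigr => k _; rewrite Ffoot; ring.
  have FbN : F (body N) j / betaN = (src (body N) j)%:C
      - \sum_(k < N.-1) (alpha k.+1)%:C * F (foot k) j.
    by rewrite [X in X / _]Fbody mulfK.
  by rewrite mulrBr div1r FbN sumE; ring.
have src00 : src (body N) (body N) = 1.
  by rewrite /src /source eqxx /site_pi/= invr1.
have srck0 k : src (foot k) (body N) = 0 by [].
have src0k k : src (body N) (foot k) = 0 by [].
have srckl k l : src (foot k) (foot l)
    = if k == l then c 1%N k.+1 / alpha k.+1 else 0.
  rewrite /src /source (inj_eq (@rshift_inj _ _)); case: eqP => // _.
  by rewrite /site_pi /spider_pi/= big_geq// big_nat1 mulr1 invf_div.
(* The column of the body: its equation shows that the pivot is invertible. *)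
have F00 : F (body N) (body N) * (1 / betaN - tau) = 1.
  by rewrite Fsolve src00 big1 ?subr0 // => k _; rewrite srck0 mulr0.
have D_neq0 : 1 / betaN - tau != 0.
  by apply/eqP => D0; move: F00 => /eqP; rewrite D0 mulr0 eq_sym oner_eq0.
have bE : spider_b N alpha c omega z = 1 / (1 / betaN - tau).
  rewrite /spider_b; congr (1 / (_ - _)); rewrite mxE; apply: eq_bigr => k _.
  by rewrite mul_mx_diag !mxE.
have alphaC_neq0 (k : 'I_N.-1) : (alpha k.+1)%:C != 0.
  by rewrite fmorph_eq0 gt_eqF//; case: hrates => _ _ h _; exact: h (kN' k).
have srcklC k l : (src (foot k) (foot l))%:C
    = if k == l then (c 1%N k.+1)%:C / (alpha k.+1)%:C else 0.
  by rewrite srckl; case: eqP => // _; rewrite fmorph_div.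
have F0l l : F (body N) (foot l)
    = spider_b N alpha c omega z * (- ((c 1%N l.+1)%:C * beta l)).
  apply: (mulIf D_neq0); rewrite Fsolve src0k bE (bigD1 l)//= big1 => [|k kl].
    by rewrite srcklC eqxx [RHS]mulrAC divfK// mul1r; field; exact: alphaC_neq0.
  by rewrite srcklC (negbTE kl) mulr0.
have F00E : F (body N) (body N) = spider_b N alpha c omega z.
  by apply: (mulIf D_neq0); rewrite F00 bE divfK.
rewrite -/F; clearbody F.
apply/matrixP => i j; rewrite [RHS]mxE [X in _ = _ + X]mxE.
case: (split_ordP i) => k ->; case: (split_ordP j) => l ->.
- rewrite !block_mxEul !ord1 mxE add0r [X in _ = _ * X]mxE eqxx mulr1.
  exact: F00E.
- rewrite !block_mxEur ord1 mxE add0r mxE /BD /diag_stieltjes mul_mx_diag.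
  by rewrite -/(foot l) -/(body N) F0l !mxE.
- rewrite !block_mxEdl ord1 mxE add0r mxE /BD /diag_stieltjes mul_diag_mx.
  by rewrite -/(foot k) -/(body N) Ffoot srck0 F00E !mxE /beta; ring.
- rewrite !block_mxEdr -/(foot l) -/(foot k) Ffoot F0l srcklC.
  rewrite /alphaD invmx_diag_mx; last by move=> m; rewrite !mxE.
  rewrite /BD /diag_stieltjes /cD mulmx_diag -mulmxA !mul_mx_diag !mul_diag_mx.
  rewrite !mxE big_ord1 !mxE /beta.
  by case: (eqVneq k l) => [->|kl]; rewrite ?mulr1n ?mulr0n; ring.
Qed.
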